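(* Let $q$ be a prime and let $G$ be a non-cyclic $q^*$-group of order $n$ (that is, $G$ is a non-cyclic finite group of order $n$ and $q$ is the least prime divisor of $n$). Then $$\psi(G)\leq \frac{((q^2-1)q+1)(q+1)}{q^5+1}\,\psi(C_n),$$ and equality holds if and only if $n=q^2k$ for some positive integer $k$ with $(k,q!)=1$ and $$G\cong (C_q\times C_q)\times C_k.$$
   Context: All groups are finite. For a finite group $G$, $\psi(G)=\sum_{x\in G} o(x)$, where $o(x)$ denotes the order of the element $x$. $C_m$ denotes the cyclic group of order $m$. $(a,b)$ denotes the greatest common divisor of the integers $a,b$, and $q!$ is the factorial of $q$. For a prime $q$, a group $G$ is called a $q^*$-group if $q$ is the least prime divisor of the order of $G$. *)

(* Defs.v *)
From mathcomp Require Import all_boot all_order all_algebra all_fingroup all_solvable.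

Set Implicit Arguments.
Unset Strict Implicit.
Unset Printing Implicit Defensive.

Import GroupScope.

Definition psi (gT : finGroupType) (G : {set gT}) : nat := (\sum_(x in G) #[x])%N.

(* pdiv m is the least prime divisor of m when 1 < m, and the non-prime 1 otherwise,
   so for a prime q this forces #|G| > 1. *)
Definition qstar_group (q : nat) (gT : finGroupType) (G : {set gT}) : bool :=
  pdiv #|G| == q.

(* Zp n is the additive group of integers mod n: cyclic of order n for every n > 0, including
   n = 1, where it is the trivial subgroup of the carrier 'Z_1 (which has two elements). *)
Definition Cyc (n : nat) : {group 'Z_n} := Zp_group n.

(* Main.v *)
Require Import Defs.
From mathcomp Require Import all_boot all_order all_algebra all_fingroup all_solvable.
From mathcomp Require Import ring lra zify.

(** The constant is N / D with N = q^3 - q + 1 and D = q^4 - q^3 + q^2 - q + 1,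
    which are the values of psi at C_q x C_q and at the cyclic group of order q^2; this is
    why C_q x C_q, and its products with a cyclic group of order coprime to q, attain it.

    The bound D psi(G) <= N psi(C_n) goes by induction on n. Let p be the largest prime
    divisor of n. Multiplying the values of psi at cyclic groups of prime power order
    gives psi(C_n) >= q n^2 / (p + 1) ([psiC_lower_bound]), since the product of r / (r + 1)
    over distinct primes r from q to p is at least q / (p + 1). There are three cases.

    If p = q, then G is a q-group of order q^a, and orders of elements are at most q^(a-1).
    When x has that order, the subgroup generated by x^q contributes only
    psi(C_(q^(a-2))) to psi(G); the resulting estimate is sharp for a = 2 and strict for
    a > 2 ([psi_pgroup_bound]).

    If p > q and every element has order at most n / p, then psi(G) <= n^2 / p already
    beats the lower bound for psi(C_n), except when q = 2 and p = 3, where an element of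
    order n / 3 has a square of order n / 6 and this gains enough ([psi_small_orders]).

    Otherwise some cyclic subgroup has index less than p. It contains a Sylow p-subgroup P
    of G and normalises it, so the number of Sylow p-subgroups is less than p, hence 1
    ([normal_cyclic_Sylow]), and G = P ><| F with P cyclic. An element v of F that does
    not centralise P acts on P without fixed points, and all of P v consists of
    elements of order #[v] ([order_fpf_mul]). Therefore, with Z = 'C_F(P),
      psi(G) = psi(P) psi(Z) + |P| (psi(F) - psi(Z)) <= psi(P) psi(F),
    with equality exactly when F centralises P. If F is not cyclic, the induction
    hypothesis for F finishes the proof, and in the case of equality G = P x F carries over
    the structure of F. If F is cyclic, then Z is a proper subgroup because G is not
    cyclic, and the displayed formula is strictly below the bound ([psi_frobenius_lt]). *)

Set Implicit Arguments.
Unset Strict Implicit.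
Unset Printing Implicit Defensive.

Import GroupScope.
Import Order.TTheory GRing.Theory Num.Theory.
Local Open Scope nat_scope.

(** * Sums of element orders in subgroups and products *)

Section PsiGeneral.

Variable gT : finGroupType.
Implicit Types G H K P F A B : {group gT}.

Lemma psi_isog (rT : finGroupType) G (H : {group rT}) :
  G \isog H -> psi G = psi H.
Proof.
case/isogP=> f injf <-; rewrite /psi morphimEdom big_imset; last exact/injmP.
by apply: eq_bigr => x Gx; rewrite order_injm.
Qed.

Lemma psi_sub G H : H \subset G -> psi H <= psi G.
Proof.
by move=> sHG; rewrite /psi [leqRHS](big_setID H) (setIidPr sHG) leq_addr.
Qed.

Lemma psi_proper G H : H \proper G -> psi H < psi G.
Proof.
case/properP=> sHG [x Gx H'x].
rewrite {2}/psi (big_setID H) (setIidPr sHG) -addn1 leq_add2l.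
by rewrite (bigD1 x) ?inE ?H'x ?Gx //= addn_gt0 order_gt0.
Qed.

Lemma card_le_psi G : #|G| <= psi G.
Proof. by rewrite -sum1_card leq_sum // => x _; apply: order_gt0. Qed.

Lemma card_lt_psi G : G :!=: 1%g -> #|G| < psi G.
Proof.
case/trivgPn=> x Gx ntx; rewrite -sum1_card /psi (bigD1 x) //= [ltnRHS](bigD1 x) //=.
rewrite -addSn leq_add ?order_gt1 //.
by apply: leq_sum => y _; apply: order_gt0.
Qed.

Lemma psi_le_card_mul G m : {in G, forall x, #[x] <= m} -> psi G <= #|G| * m.
Proof. by move=> leGm; rewrite -sum_nat_const leq_sum. Qed.

(** Counting the elements of a subgroup K separately is what sharpens the crude bound
    |G| m: for K the proper powers of an element of maximal order, psi K is small. *)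
Lemma psi_le_off_subgroup G K m : K \subset G -> {in G, forall x, #[x] <= m} ->
  psi G <= psi K + (#|G| - #|K|) * m.
Proof.
move=> sKG leGm; rewrite {1}/psi (big_setID K) (setIidPr sKG) leq_add2l.
rewrite -cardsDS // -sum_nat_const leq_sum // => x /setDP[Gx _].
exact: leGm.
Qed.

Lemma sum_sdprod P F G (f : gT -> nat) : P ><| F = G ->
  \sum_(g in G) f g = \sum_(v in F) \sum_(u in P) f (u * v)%g.
Proof.
case/sdprodP=> _ <- _ tiPF; rewrite exchange_big pair_big_dep /=.
rewrite (_ : (P * F)%g = [set (x.1 * x.2)%g | x in setX P F]); last first.
  apply/setP=> g; apply/mulsgP/imsetP=> [[u v Pu Fv ->] | [[u v] /setXP[Pu Fv] ->]].
    by exists (u, v); rewrite // inE Pu.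
  by exists u v.
rewrite big_imset /=; first by apply: eq_bigl => x; rewrite inE.
case=> x u [y v] /setXP[/= Px Fu] /setXP[/= Py Fv] eq_xu.
by rewrite -(divgrMid tiPF Px Fu) -{2}(remgrMid tiPF Px Fu) eq_xu divgrMid ?remgrMid.
Qed.

Lemma psi_dprod A B G : A \x B = G -> coprime #|A| #|B| -> psi G = psi A * psi B.
Proof.
move=> defG coAB; have [_ _ cAB _] := dprodP defG.
rewrite {1}/psi (sum_sdprod _ (dprodWsd defG)) exchange_big big_distrlr /=.
apply: eq_bigr => a Aa; apply: eq_bigr => b Bb; rewrite orderM //.
  by apply/esym; apply: (centsP cAB).
by apply: coprime_dvdl (coprime_dvdr _ coAB); apply: order_dvdG.
Qed.

(** By coprime action [~: P, v] and 'C_P[v] meet trivially. In a cyclic p-group this makes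
    one of them trivial, and [~: P, v] is not. So v fixes only 1 in P; but (u v)^#[v] lies
    in P and commutes with u and u v, hence with v. *)
Lemma order_fpf_mul (p : nat) P v u : p.-group P -> cyclic P -> v \in 'N(P) -> p^'.-elt v ->
  v \notin 'C(P) -> u \in P -> #[(u * v)%g] = #[v].
Proof.
move=> pP cycP nPv p'v ncPv Pu.
have nPV: <[v]> \subset 'N(P) by rewrite cycle_subG.
have coPV: coprime #|P| #|<[v]>| by rewrite (pnat_coprime pP).
have abP := cyclic_abelian cycP.
have tiPv: 'C_P[v] = 1%g.
  rewrite -cent_cycle.
  have sRP : [~: P, <[v]>] \subset P by rewrite commg_subl.
  have := coprime_abel_cent_TI nPV coPV abP.
  rewrite -(setIidPl sRP) -setIA => tiRC.
  have [P1 | ntP] := eqVneq (P : {set gT}) 1%g; first by rewrite P1 setI1g.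
  have [p_pr _ _] := pgroup_pdiv pP ntP.
  (* The subgroup of order p lies in every nontrivial subgroup of P. *)
  have prK : prime #|'Ohm_1(P)| by rewrite (Ohm1_cyclic_pgroup_prime cycP pP ntP).
  case: (prime_subgroupVti 'C_P(<[v]>) prK) => [sKC | /TI_Ohm1]; last first.
    by rewrite (setIidPl (subsetIl _ _)).
  case: (prime_subgroupVti [~: P, <[v]>] prK) => [sKR | /TI_Ohm1]; last first.
    rewrite (setIidPl sRP) => /commG1P cVP.
    by case/negP: ncPv; rewrite -cycle_subG centsC.
  have /trivgP K1 : 'Ohm_1(P) \subset [1 gT] by rewrite -tiRC subsetI sKR.
  by rewrite K1 cards1 in prK.
(* Modulo P, the elements u v and v agree. *)
have Pexp k : (((u * v) ^+ k) \in P%g) = (v ^+ k \in P%g).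
  have Nuv: (u * v)%g \in 'N(P) by rewrite groupM // (subsetP (normG P)).
  have [Nuvk Nvk] : (u * v) ^+ k \in 'N(P) /\ v ^+ k \in 'N(P) by rewrite !groupX.
  have eq_coset : coset P ((u * v) ^+ k) = coset P (v ^+ k).
    by rewrite !morphX //= coset_kerl.
  by apply/idP/idP=> /coset_id; [rewrite eq_coset | rewrite -eq_coset]; apply: coset_idr.
apply/eqP; rewrite eqn_dvd !order_dvdn; apply/andP; split.
  have Puv : ((u * v) ^+ #[v])%g \in P by rewrite Pexp expg_order group1.
  have : ((u * v) ^+ #[v])%g \in 'C_P[v]; last by rewrite tiPv => /set1P->.
  rewrite inE Puv; apply/cent1P.
  have cuv_u : commute ((u * v) ^+ #[v])%g u by apply: (centsP abP).
  have cuv_uv : commute ((u * v) ^+ #[v])%g (u * v)%g by apply/commute_sym/commuteX.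
  rewrite -[X in commute _ X](mulKg u v); apply: commuteM cuv_uv.
  exact: commuteV.
have Pv : (v ^+ #[(u * v)%g])%g \in P by rewrite -Pexp expg_order group1.
have : (v ^+ #[(u * v)%g])%g \in P :&: <[v]> by rewrite inE Pv mem_cycle.
by rewrite coprime_TIg // => /set1P->.
Qed.

(** Sum over the cosets P v, v in F: if v centralises P, the orders multiply; otherwise
    every element of the coset has the order of v. *)
Lemma psi_cyclic_sdprod (p : nat) P F G : p.-group P -> cyclic P -> p^'.-group F ->
  P ><| F = G ->
  psi G = psi P * psi 'C_F(P) + #|P| * (psi F - psi 'C_F(P)).
Proof.
move=> pP cycP p'F defG; have [_ _ nPF _] := sdprodP defG.
rewrite {1}/psi (sum_sdprod _ defG) (big_setID 'C(P)) /=; congr (_ + _).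
  rewrite mulnC /psi big_distrlr /=; apply: eq_bigr => v /setIP[Fv cPv].
  apply: eq_bigr => u Pu; rewrite mulnC orderM //; first by apply/commute_sym/(centP cPv).
  exact: pnat_coprime (mem_p_elt pP Pu) (mem_p_elt p'F Fv).
have -> : psi F - psi 'C_F(P) = \sum_(v in F :\: 'C(P)) #[v].
  by rewrite {1}/psi (big_setID 'C(P)) addKn.
rewrite big_distrr /=; apply: eq_bigr => v /setDP[Fv ncPv].
rewrite -sum_nat_const; apply: eq_bigr => u Pu.
by rewrite (order_fpf_mul pP) ?(subsetP nPF) // (mem_p_elt p'F).
Qed.

End PsiGeneral.

Lemma setX1_isog (aT bT : finGroupType) (A : {group aT}) :
  A \isog setX A [1 bT].
Proof. by rewrite -morphim_pairg1 sub_isog ?subsetT ?injm_pairg1. Qed.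

Lemma set1X_isog (aT bT : finGroupType) (B : {group bT}) :
  B \isog setX [1 aT] B.
Proof. by rewrite -morphim_pair1g sub_isog ?subsetT ?injm_pair1g. Qed.

Lemma psi_setX (aT bT : finGroupType) (A : {group aT}) (B : {group bT}) :
  coprime #|A| #|B| -> psi (setX A B) = psi A * psi B.
Proof.
move=> coAB; have [isoA isoB] := (setX1_isog bT A, set1X_isog aT B).
rewrite (psi_dprod (setX_dprod A B)) ?(psi_isog isoA) ?(psi_isog isoB) //.
by rewrite -(card_isog isoA) -(card_isog isoB).
Qed.


(** * Sums of element orders in cyclic groups *)

Local Notation psiC n := (psi (Cyc n)).

Lemma Cyc_cyclic n : cyclic (Cyc n).
Proof.
rewrite /Cyc /= /Zp; case: ifP => _; last exact: cyclic1.
by rewrite Zp_cycle cycle_cyclic.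
Qed.

Lemma card_Cyc n : 0 < n -> #|Cyc n| = n.
Proof. exact: card_Zp. Qed.

Lemma isog_Cyc (gT : finGroupType) (G : {group gT}) : cyclic G -> G \isog Cyc #|G|.
Proof. by move=> cycG; rewrite isog_cyclic_card // Cyc_cyclic card_Cyc /=. Qed.

Lemma psi_cyclic (gT : finGroupType) (G : {group gT}) : cyclic G -> psi G = psiC #|G|.
Proof. by move/isog_Cyc/psi_isog. Qed.

Lemma psiC_le_square n : 0 < n -> psiC n <= n ^ 2.
Proof.
move=> n_gt0; have oG := card_Cyc n_gt0.
rewrite -mulnn -[X in X * _]oG; apply: psi_le_card_mul => x Gx.
by rewrite dvdn_leq // -[X in _ %| X]oG order_dvdG.
Qed.

Lemma psiC_ge n : 0 < n -> n <= psiC n.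
Proof. by move=> n_gt0; rewrite -{1}(card_Cyc n_gt0) card_le_psi. Qed.

Lemma psiC_mul a b : 0 < a -> 0 < b -> coprime a b -> psiC (a * b) = psiC a * psiC b.
Proof.
move=> a_gt0 b_gt0 co_ab.
have coAB : coprime #|Cyc a| #|Cyc b| by rewrite !card_Cyc.
rewrite -psi_setX //; apply/esym/psi_isog.
have [isoA isoB] := (setX1_isog ('Z_b) (Cyc a), set1X_isog ('Z_a) (Cyc b)).
have cycX : cyclic (setX (Cyc a) (Cyc b)).
  rewrite (cyclic_dprod (setX_dprod (Cyc a) (Cyc b))).
  - by rewrite -(card_isog isoA) -(card_isog isoB).
  - by rewrite -(isog_cyclic isoA) Cyc_cyclic.
  by rewrite -(isog_cyclic isoB) Cyc_cyclic.
rewrite isog_cyclic_card // Cyc_cyclic cardsX !card_Cyc ?muln_gt0 ?a_gt0 //=.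
Qed.

Lemma psiC_dvd m n : 0 < n -> m %| n -> psiC m <= psiC n.
Proof.
move=> n_gt0 dv_mn; have m_gt0 := dvdn_gt0 n_gt0 dv_mn.
have /cyclicP[x defG] := Cyc_cyclic n; have oG := card_Cyc n_gt0.
have ox : #[x]%g = n by rewrite orderE -defG.
have <- : #|<[x ^+ (n %/ m)]>%g| = m.
  by rewrite -orderE orderXdiv ox ?dvdn_divl ?divnA ?mulKn ?dvdn_div //.
rewrite -psi_cyclic ?cycle_cyclic //; apply: psi_sub.
by rewrite defG cycleX.
Qed.

Lemma psiC1 : psiC 1 = 1.
Proof.
by apply/eqP; rewrite eqn_leq psiC_ge ?psiC_le_square.
Qed.

(** The elements outside the subgroup of index p are the generators. *)
Lemma psiC_primeXS p a : prime p ->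
  psiC (p ^ a.+1) = psiC (p ^ a) + p.-1 * p * p ^ (2 * a).
Proof.
move=> p_pr; have p_gt0 := prime_gt0 p_pr.
have := card_Cyc (_ : 0 < p ^ a.+1); rewrite expn_gt0 p_gt0 => /(_ isT).
move: (Cyc_cyclic (p ^ a.+1)); move: (Cyc _) => G cycG oG.
have /cyclicP[x defG] := cycG.
have ox : #[x]%g = p ^ a.+1 by rewrite orderE -defG.
have sKG : <[x ^+ p]>%g \subset G by rewrite defG cycleX.
have oK : #|<[x ^+ p]>%g| = p ^ a.
  by rewrite -orderE orderXdiv ox ?dvdn_exp // expnS mulKn.
rewrite {1}/psi (big_setID <[x ^+ p]>%g) (setIidPr sKG) /= -/(psi _).
rewrite (psi_cyclic (cycle_cyclic _)) oK; congr (_ + _).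
have ordG : {in G :\: <[x ^+ p]>%g, forall y, #[y]%g = p ^ a.+1}.
  move=> y /setDP[Gy]; apply: contraNeq => ne_oy.
  suff dv_oy : #[y]%g %| p ^ a.
    by rewrite -cycle_subG -(cardSg_cyclic cycG) ?oK ?cycle_subG // -cycle_subG.
  have /(dvdn_pfactor _ _ p_pr)[k le_ka oy] : #[y]%g %| p ^ a.+1.
    by rewrite -[X in _ %| X]oG order_dvdG.
  rewrite oy dvdn_exp2l // -ltnS ltn_neqAle le_ka andbT.
  by apply: contraNneq ne_oy => def_k; rewrite oy def_k.
rewrite (eq_bigr _ ordG) sum_nat_const cardsDS // oK oG expnS -subn1 !mulnBl !mul1n.
by rewrite mul2n -addnn expnD; lia.
Qed.

Lemma psiC_primeX p a : prime p -> p.+1 * psiC (p ^ a) = p ^ (2 * a).+1 + 1.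
Proof.
move=> p_pr; have p_gt0 := prime_gt0 p_pr; elim: a => [|a IHa].
  by rewrite expn0 psiC1; lia.
rewrite psiC_primeXS // mulnDr IHa !mulnS !expnS.
case: p {p_pr IHa} p_gt0 => // p _ /=; lia.
Qed.

(** Only the r-part of n changes, and for a power r^a the generators of the cyclic group of
    order r^a.+1 add r (r - 1) r^(2 a), which is at least r (r - 1) psi(C_(r^a)). *)
Lemma psiC_mul_prime r n : prime r -> 0 < n ->
  (r.-1 * r + 1) * psiC n <= psiC (n * r).
Proof.
move=> r_pr n_gt0; have r_gt0 := prime_gt0 r_pr.
have [m co_rm ->] := pfactor_coprime r_pr n_gt0; move: (logn r n) => a.
have m_gt0 : 0 < m by case: m co_rm r_pr => //; rewrite /coprime gcdn0 => /eqP->.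
have co_m k : coprime m (r ^ k) by rewrite coprime_sym coprimeXl.
rewrite -mulnA -expnSr !psiC_mul ?expn_gt0 ?r_gt0 // psiC_primeXS //.
rewrite mulnCA leq_mul2l mulnDl mul1n addnC leq_add2l leq_mul2l.
apply/orP; right; apply/orP; right.
by rewrite mul2n -muln2 expnM psiC_le_square // expn_gt0 r_gt0.
Qed.

Lemma psiC_proper_dvd q m n : 0 < n -> m %| n -> m != n ->
  (forall r, prime r -> r %| n -> q <= r) ->
  (q.-1 * q + 1) * psiC m <= psiC n.
Proof.
move=> n_gt0 /dvdnP[d def_n] ne_mn q_le; have m_gt0 : 0 < m by lia.
have d_gt1 : 1 < d by case: d def_n => [|[|d]] //; lia.
have r_pr := pdiv_prime d_gt1.
have le_qr : q <= pdiv d by rewrite q_le // def_n dvdn_mulr ?pdiv_dvd.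
have dv_mr : m * pdiv d %| n by rewrite def_n mulnC dvdn_pmul2r ?pdiv_dvd.
apply: leq_trans (psiC_dvd n_gt0 dv_mr).
apply: leq_trans (psiC_mul_prime r_pr m_gt0).
rewrite leq_mul2r leq_add2r leq_mul ?orbT //; lia.
Qed.

(** Induction on the bound p for the primes: the p-part p^a of n contributes
    psi(C_(p^a)) > p^(2 a) p / (p + 1), and this numerator p cancels the denominator of
    the estimate for the primes at most p - 1. *)
Lemma psiC_lower_bound q p n : 0 < n -> q <= p.+1 ->
  (forall r, prime r -> r %| n -> q <= r <= p) -> q * n ^ 2 <= p.+1 * psiC n.
Proof.
have [-> _ le_qp _|n_ne1] := eqVneq n 1; first by rewrite psiC1 !muln1.
elim: p n n_ne1 => [|p IHp] n n_ne1 n_gt0 _ le_qrp.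
all: have n_gt1 : 1 < n by lia.
all: have /andP[le_qr le_rp] := le_qrp _ (pdiv_prime n_gt1) (pdiv_dvd n).
  by rewrite leqNgt pdiv_gt0 in le_rp.
have IH m : 0 < m -> m %| n -> (prime p.+1 -> ~~ (p.+1 %| m)) ->
  q * m ^ 2 <= p.+1 * psiC m.
  move=> m_gt0 dv_mn ndv_pm; have [->|m_ne1] := eqVneq m 1.
    by rewrite psiC1 !muln1 (leq_trans le_qr).
  apply: IHp => // [|r r_pr dv_rm]; first exact: leq_trans le_qr le_rp.
  have /andP[-> le_r] := le_qrp r r_pr (dvdn_trans dv_rm dv_mn).
  rewrite -ltnS ltn_neqAle le_r andbT; apply/eqP=> def_r; rewrite -def_r in ndv_pm.
  by have := ndv_pm r_pr; rewrite dv_rm.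
have [p_pr | p_npr] := boolP (prime p.+1); last first.
  apply: leq_trans (IH n n_gt0 (dvdnn n) _) _; last by rewrite leq_mul2r leqnSn orbT.
  by move=> p_pr; rewrite p_pr in p_npr.
have [m co_pm def_n] := pfactor_coprime p_pr n_gt0; move: (logn _ n) def_n => a def_n.
have m_gt0 : 0 < m by rewrite lt0n; apply: contraTneq n_gt0 => m0; rewrite def_n m0.
have {IH} : q * m ^ 2 <= p.+1 * psiC m.
  by apply: IH => //; rewrite ?def_n ?dvdn_mulr // -prime_coprime.
rewrite def_n psiC_mul ?expn_gt0 // ; last by rewrite coprime_sym coprimeXl.
have := psiC_primeX a p_pr; set x := psiC m; set y := psiC (_ ^ a).
rewrite expnS (mulnC 2 a) expnM expnMn; set z := (_ ^ a) ^ 2 => def_y le_x.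
have le_y : p.+1 * z <= p.+2 * y by lia.
rewrite -(leq_pmul2l (ltn0Sn p)).
have := leq_mul le_x le_y; lia.
Qed.

(** * The ratio N / D and the inequalities about it *)

Section Ratio.
Local Open Scope ring_scope.
Implicit Types x y a s f t : rat.

(** This is psi (C_q x C_q) as a function of x = q. *)
Definition ratio_num x := x ^+ 3 - x + 1.
(** This is psi (C_(q^2)) as a function of x = q. *)
Definition ratio_den x := x ^+ 4 - x ^+ 3 + x ^+ 2 - x + 1.

Lemma ratio_den_gt0 x : 2 <= x -> 0 < ratio_den x.
Proof.
move=> x_ge2; rewrite /ratio_den.
have -> : x ^+ 4 - x ^+ 3 + x ^+ 2 - x + 1 = x ^+ 3 * (x - 1) + x * (x - 1) + 1 by ring.
have x_gt0 : 0 < x by lra.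
have x1_gt0 : 0 < x - 1 by lra.
by rewrite !addr_gt0 // mulr_gt0 // exprn_gt0.
Qed.

Lemma ratio_factors x : 2 <= x ->
  ((x ^+ 2 - 1) * x + 1) * (x + 1) / (x ^+ 5 + 1) = ratio_num x / ratio_den x.
Proof.
move=> x_ge2; have D_gt0 := ratio_den_gt0 x_ge2.
have -> : x ^+ 5 + 1 = (x + 1) * ratio_den x by rewrite /ratio_den; ring.
have -> : (x ^+ 2 - 1) * x + 1 = ratio_num x by rewrite /ratio_num; ring.
by field; rewrite lt0r_neq0 //=; lra.
Qed.

(** The combination of the values a = psi P, f = psi F, s = psi 'C_F(P) and t = |P| in
    [psi_cyclic_sdprod]. The two hypotheses bound it by (x^3 + x^2 + 1) / (x^4 + x^2 + 1)
    times a f, and that fraction is less than the ratio: the difference of the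
    cross products is x^2 (x - 1). *)
Lemma ratio_frobenius x a t s f : 2 <= x -> 0 < a -> 0 < f -> 0 <= s ->
  s * (x ^+ 2 - x + 1) <= f -> t * (x ^+ 2 + x + 1) <= (x + 1) * a ->
  ratio_den x * (a * s + t * (f - s)) < ratio_num x * (a * f).
Proof.
move=> x_ge2 a_gt0 f_gt0 s_ge0 le_sf le_ta.
have D_gt0 := ratio_den_gt0 x_ge2; have af_gt0 : 0 < a * f by rewrite mulr_gt0.
set E := x ^+ 2 + x + 1 in le_ta; set H := x ^+ 2 - x + 1 in le_sf.
have x_gt0 : 0 < x by lra.
have E_gt0 : 0 < E by rewrite !addr_gt0 ?exprn_gt0.
have H_ge1 : 1 <= H by rewrite /H; nra.
have H_gt0 : 0 < H by lra.
have le_sf1 : s <= f by apply: le_trans le_sf; rewrite ler_peMr.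
have le1 : E * (a * s + t * (f - s)) <= a * (x ^+ 2 * s + (x + 1) * f).
  have : t * E * (f - s) <= (x + 1) * a * (f - s) by rewrite ler_wpM2r // subr_ge0.
  by rewrite /E => le2; nra.
have le2 : a * (s * H) * x ^+ 2 <= a * f * x ^+ 2.
  by rewrite ler_wpM2r ?exprn_ge0 ?ler_wpM2l // ltW.
have le3 : E * H * (a * s + t * (f - s)) <= a * f * (x ^+ 3 + x ^+ 2 + 1).
  have : H * (E * (a * s + t * (f - s))) <= H * (a * (x ^+ 2 * s + (x + 1) * f)).
    by rewrite ler_wpM2l // ltW.
  by rewrite mulrA [E * H]mulrC => /le_trans->//; move: le2; rewrite /H; lra.
have EH_gt0 : 0 < E * H by rewrite mulr_gt0.
rewrite -(ltr_pM2l EH_gt0).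
have -> : E * H * (ratio_num x * (a * f)) =
  ratio_den x * (a * f * (x ^+ 3 + x ^+ 2 + 1)) + a * f * (x ^+ 2 * (x - 1)).
  by rewrite /E /H /ratio_num /ratio_den; ring.
rewrite mulrCA; apply: le_lt_trans (_ : ratio_den x * (a * f * (x ^+ 3 + x ^+ 2 + 1)) < _).
  by rewrite ler_wpM2l // ltW.
by rewrite ltrDl !mulr_gt0 ?exprn_gt0 //; lra.
Qed.

(** Here m = psi G, c = psi (C_n) and y is the largest prime divisor of n. The claim reduces
    to (y + 1) D < y x N, whose two sides differ by y (x - 1) (x^2 - x + 1) - D; this is
    positive for y at least x + 2, but not for y = x + 1 = 3. *)
Lemma ratio_small_orders x y m n c : 2 <= x -> x + 2 <= y -> 0 < n ->
  x * n ^+ 2 <= (y + 1) * c -> m * y <= n ^+ 2 ->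
  ratio_den x * m < ratio_num x * c.
Proof.
move=> x_ge2 le_xy n_gt0 le_nc le_mn.
have D_gt0 := ratio_den_gt0 x_ge2; have n2_gt0 : 0 < n ^+ 2 by rewrite exprn_gt0.
have y_gt0 : 0 < y by lra. have y1_gt0 : 0 < y + 1 by lra.
have N_gt0 : 0 < ratio_num x by rewrite /ratio_num; nra.
rewrite -(ltr_pM2l (mulr_gt0 y_gt0 y1_gt0)).
have le1 : y * (y + 1) * (ratio_den x * m) <= (y + 1) * ratio_den x * n ^+ 2.
  have -> : y * (y + 1) * (ratio_den x * m) = (y + 1) * ratio_den x * (m * y) by ring.
  by rewrite ler_wpM2l // mulr_ge0 // ltW.
have le2 : y * ratio_num x * (x * n ^+ 2) <= y * (y + 1) * (ratio_num x * c).
  have -> : y * (y + 1) * (ratio_num x * c) = y * ratio_num x * ((y + 1) * c) by ring.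
  by rewrite ler_wpM2l // mulr_ge0 // ltW.
apply: le_lt_trans le1 (lt_le_trans _ le2); rewrite [ltRHS]mulrA ltr_pM2r //.
have -> : y * ratio_num x * x = (y + 1) * ratio_den x
   + ((y - (x + 2)) * ((x - 1) * (x ^+ 2 - x + 1)) + (x ^+ 3 - 3 * x ^+ 2 + 4 * x - 3)).
  by rewrite /ratio_num /ratio_den; ring.
rewrite ltrDl ltr_wpDl //.
  rewrite mulr_ge0 ?mulr_ge0 //; [lra | lra | nra].
have -> : x ^+ 3 - 3 * x ^+ 2 + 4 * x - 3 = (x - 2) * (x ^+ 2 - x + 2) + 1 by ring.
have : 0 <= (x - 2) * (x ^+ 2 - x + 2) by rewrite mulr_ge0 //; [lra | nra].
lra.
Qed.

(** For |G| = x^(b+2) this is used with y = x^(2b+1), u = psi (C_(x^b)) and c = psi (C_|G|).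
    After multiplication by x + 1, the gap between N c and D times the bound for m is
    x (x - 1)^2 (y - x), which also gives the equality case. *)
Lemma ratio_pgroup x y u c m : 2 <= x -> x <= y ->
  (x + 1) * u = y + 1 -> (x + 1) * c = x ^+ 4 * y + 1 -> m + y <= u + x ^+ 2 * y ->
  ratio_den x * m <= ratio_num x * c /\
  (ratio_den x * m = ratio_num x * c -> y = x).
Proof.
move=> x_ge2 le_xy def_u def_c le_m; have D_gt0 := ratio_den_gt0 x_ge2.
have x1_gt0 : 0 < x + 1 by lra.
have k_gt0 : 0 < x * (x - 1) ^+ 2 by rewrite mulr_gt0 ?exprn_gt0 //; lra.
have le1 : (x + 1) * (ratio_den x * m)
           <= (x + 1) * (ratio_den x * (u + (x ^+ 2 - 1) * y)).
  by rewrite ler_pM2l // ler_pM2l //; lra.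
have eq1 : (x + 1) * (ratio_num x * c) =
    (x + 1) * (ratio_den x * (u + (x ^+ 2 - 1) * y)) + x * (x - 1) ^+ 2 * (y - x).
  transitivity (ratio_num x * ((x + 1) * c)); first by ring.
  transitivity (ratio_den x * ((x + 1) * u + (x + 1) * (x ^+ 2 - 1) * y)
    + x * (x - 1) ^+ 2 * (y - x)); last by ring.
  by rewrite def_u def_c /ratio_num /ratio_den; ring.
have le2 : 0 <= x * (x - 1) ^+ 2 * (y - x) by rewrite mulr_ge0 ?subr_ge0 // ltW.
split; first by rewrite -(ler_pM2l x1_gt0) eq1; lra.
move=> eq_mc; have /eqP : x * (x - 1) ^+ 2 * (y - x) = 0.
  by move: eq1 le1 le2; rewrite -eq_mc; lra.
by rewrite mulf_eq0 gt_eqF //= subr_eq0 => /eqP.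
Qed.

End Ratio.

(** The denominator is cleared so that a common factor of m and c, such as psi P in the
    induction step, can be cancelled directly. *)
Definition psi_ratio_le q m c :=
  (ratio_den q%:R * m%:R <= ratio_num q%:R * c%:R :> rat)%R.
Definition psi_ratio_eq q m c :=
  (ratio_den q%:R * m%:R = ratio_num q%:R * c%:R :> rat)%R.
Definition psi_ratio_lt q m c :=
  (ratio_den q%:R * m%:R < ratio_num q%:R * c%:R :> rat)%R.

Lemma psi_ratio_lt_strict q m c (Q : Prop) :
  psi_ratio_lt q m c -> psi_ratio_le q m c /\ (psi_ratio_eq q m c -> Q).
Proof.
move=> lt_mc; split=> [|eq_mc]; first exact: ltW.
by have := lt_eqF lt_mc; rewrite eq_mc eqxx.
Qed.

(** * Groups of prime power order *)

Lemma order_lt_card (gT : finGroupType) (G : {group gT}) x :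
  ~~ cyclic G -> x \in G -> #[x]%g < #|G|.
Proof.
move=> ncG Gx; rewrite ltn_neqAle (dvdn_leq _ (order_dvdG Gx)) // andbT.
apply: contra ncG => /eqP ox; apply/cyclicP; exists x.
by apply/eqP; rewrite eq_sym eqEcard cycle_subG Gx -ox orderE leqnn.
Qed.

(** If some x has the largest possible order q^(b+1), use [psi_le_off_subgroup] with the
    subgroup generated by x^q; if not, all orders are at most q^b and psi G is much smaller.
    The term q^(2b+1) stands on the left to avoid a truncated subtraction. *)
Lemma psi_pgroup_le q b (gT : finGroupType) (G : {group gT}) :
  prime q -> #|G| = q ^ b.+2 -> ~~ cyclic G ->
  psi G + q ^ (2 * b).+1 <= psiC (q ^ b) + q ^ 2 * q ^ (2 * b).+1.
Proof.
move=> q_pr oG ncG; have q_gt1 := prime_gt1 q_pr; have q_gt0 := ltnW q_gt1.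
have ordG : {in G, forall x, exists2 k, k <= b.+1 & #[x]%g = q ^ k}.
  move=> x Gx; have := order_dvdG Gx; rewrite oG => /(dvdn_pfactor _ _ q_pr)[k le_k ox].
  exists k => //; have := order_lt_card ncG Gx.
  by rewrite oG ox ltn_exp2l.
pose z := q ^ b; have z_gt0 : 0 < z by rewrite expn_gt0 q_gt0.
have def_z : q ^ (2 * b).+1 = q * (z * z) by rewrite expnS mul2n -addnn expnD.
have [/exists_inP[x Gx /eqP ox]|no_x] := boolP [exists x in G, #[x]%g == q ^ b.+1].
  have oK : #|<[x ^+ q]>%g| = z.
    by rewrite -orderE orderXdiv ox ?dvdn_exp // expnS mulKn.
  have sKG : <[x ^+ q]>%g \subset G by rewrite cycle_subG groupX.
  have leG : {in G, forall y, #[y]%g <= q ^ b.+1}.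
    by move=> y /ordG[k le_kb ->]; rewrite leq_exp2l.
  have := psi_le_off_subgroup sKG leG.
  rewrite (psi_cyclic (cycle_cyclic _)) oK oG def_z !expnS -/z expn0; nia.
have leG : {in G, forall y, #[y]%g <= z}.
  move=> y Gy; have [k le_kb oy] := ordG y Gy; rewrite oy leq_exp2l //.
  rewrite -ltnS ltn_neqAle le_kb andbT; apply/eqP=> def_k; case/exists_inP: no_x.
  by exists y => //; rewrite oy def_k.
have := psi_le_card_mul leG; rewrite oG def_z !expnS -/z expn0.
have := psiC_ge z_gt0; nia.
Qed.

Lemma psi_pgroup_bound q (gT : finGroupType) (G : {group gT}) :
  prime q -> q.-group G -> ~~ cyclic G ->
  psi_ratio_le q (psi G) (psiC #|G|)
  /\ (psi_ratio_eq q (psi G) (psiC #|G|) -> #|G| = q ^ 2).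
Proof.
move=> q_pr qG ncG; have q_gt1 := prime_gt1 q_pr.
have [b oG] : exists b, #|G| = q ^ b.+2.
  have [/= [|[|b]] oG] := p_natP qG; last by exists b.
    by case/negP: ncG; rewrite (card1_trivg oG) cyclic1.
  by case/negP: ncG; rewrite prime_cyclic // oG expn1.
have le_psi : ((psi G)%:R + (q ^ (2 * b).+1)%:R
    <= (psiC (q ^ b))%:R + (q ^ 2)%:R * (q ^ (2 * b).+1)%:R :> rat)%R.
  by rewrite -natrM -!natrD ler_nat psi_pgroup_le.
have def_u : ((q%:R + 1) * (psiC (q ^ b))%:R = (q ^ (2 * b).+1)%:R + 1 :> rat)%R.
  by rewrite natr1 -natrM psiC_primeX // natrD.
have def_c : ((q%:R + 1) * (psiC #|G|)%:R = q%:R ^+ 4 * (q ^ (2 * b).+1)%:R + 1 :> rat)%R.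
  rewrite natr1 -natrM oG psiC_primeX // natrD -natrX -natrM -expnD.
  by rewrite (_ : (2 * b.+2).+1 = 4 + (2 * b).+1) //; lia.
rewrite (natrX _ q 2) in le_psi.
have le_qy : (q%:R <= (q ^ (2 * b).+1)%:R :> rat)%R.
  by rewrite ler_nat -{1}(expn1 q) leq_exp2l.
have q_ge2 : (2 <= q%:R :> rat)%R by rewrite ler_nat.
have [le_m eq_m] := ratio_pgroup q_ge2 le_qy def_u def_c le_psi.
split=> // /eq_m/eqP; rewrite eqr_nat -{2}(expn1 q) eqn_exp2l // => /eqP[] /eqP.
by rewrite oG muln_eq0 => /eqP->.
Qed.

(** * Groups without large cyclic subgroups *)

(** The bound n^2 / 3 for psi G just fails to suffice here. If an element x has order n / 3,
    its square has order n / 6 =: m, and psi G <= m^2 + 5 m (2 m) = 11 m^2, while the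
    hypothesis reads 18 m^2 <= psi (C_n). If there is none, orders are at most n / 4. *)
Lemma psi_small_orders_23 (gT : finGroupType) (G : {group gT}) :
  2 %| #|G| -> 2 * #|G| ^ 2 <= 4 * psiC #|G| ->
  {in G, forall x, #[x]%g * 3 <= #|G|} -> 11 * psi G < 7 * psiC #|G|.
Proof.
move=> dv2G le_C leG; have G_gt0 := cardG_gt0 G; have := psiC_ge G_gt0 => C_ge.
have [/exists_inP[x Gx /eqP ox]|no_x] := boolP [exists x in G, #[x]%g * 3 == #|G|].
  have dv2x : 2 %| #[x]%g by rewrite -ox Gauss_dvdl in dv2G.
  have oK : #|<[x ^+ 2]>%g| = #[x]%g %/ 2 by rewrite -orderE orderXdiv.
  have sKG : <[x ^+ 2]>%g \subset G by rewrite cycle_subG groupX.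
  have leGx : {in G, forall y, #[y]%g <= #[x]%g}.
    by move=> y /leG; rewrite -ox leq_pmul2r.
  have := psi_le_off_subgroup sKG leGx; rewrite (psi_cyclic (cycle_cyclic _)) oK.
  have := divnK dv2x; set m := _ %/ 2 => def_x.
  have m_gt0 : 0 < m by have := order_gt0 x; lia.
  have oG : #|G| = 6 * m by lia.
  have -> : #|G| - m = 5 * m by lia.
  have := psiC_le_square m_gt0; rewrite -def_x -mulnn => le_m le_psi.
  have : 18 * (m * m) <= psiC #|G|.
    by move: le_C; set C := psi _; rewrite oG -mulnn; nia.
  have : 0 < m * m by rewrite muln_gt0 m_gt0.
  lia.
have leG4 : {in G, forall y, #[y]%g <= #|G| %/ 4}.
  move=> y Gy; have [k def_k] := dvdnP (order_dvdG Gy).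
  have := leG y Gy; have y_gt0 := order_gt0 y.
  have k_ne3 : k != 3.
    by apply: contraNneq no_x => k3; apply/exists_inP; exists y => //; rewrite def_k k3 mulnC.
  rewrite leq_divRL // def_k mulnC leq_pmul2r // (mulnC #[y]%g) leq_pmul2r //; lia.
have le4 : psi G * 4 <= #|G| ^ 2.
  rewrite -mulnn; apply: leq_trans (leq_mul (leqnn #|G|) (leq_divM #|G| 4)).
  by rewrite mulnA leq_pmul2r ?psi_le_card_mul.
by have := leq_trans G_gt0 C_ge; lia.
Qed.

Lemma psi_small_orders q p (gT : finGroupType) (G : {group gT}) :
  prime q -> prime p -> q < p -> q %| #|G| ->
  q * #|G| ^ 2 <= p.+1 * psiC #|G| ->
  {in G, forall x, #[x]%g * p <= #|G|} ->
  psi_ratio_lt q (psi G) (psiC #|G|).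
Proof.
move=> q_pr p_pr lt_qp dv_q le_C leG; have q_gt1 := prime_gt1 q_pr.
have [le_q2p | lt_pq2] := leqP q.+2 p.
  apply: (@ratio_small_orders _ p%:R%R _ #|G|%:R%R).
  - by rewrite ler_nat.
  - by rewrite -natrD ler_nat addn2.
  - by rewrite ltr0n.
  - by rewrite natr1 -natrX -!natrM ler_nat.
  rewrite -natrX -natrM ler_nat big_distrl /= -mulnn -sum_nat_const.
  exact: leq_sum.
(* Two consecutive primes: only 2 and 3. *)
have def_p : p = q.+1 by lia.
have def_q : q = 2.
  apply/eqP; have [//|] := even_prime q_pr; first by move->.
  move=> odd_q; have [p2|] := even_prime p_pr; first by lia.
  by rewrite def_p /= odd_q.
rewrite {p}def_p {q}def_q in p_pr q_pr lt_qp dv_q le_C leG lt_pq2 q_gt1 *.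
have [den2 num2] : (ratio_den 2%:R = 11%:R /\ ratio_num 2%:R = 7%:R)%R.
  by split; rewrite /ratio_den /ratio_num; ring.
rewrite /psi_ratio_lt den2 num2.
by rewrite -!natrM ltr_nat psi_small_orders_23.
Qed.

(** * Groups with a normal cyclic Sylow subgroup *)

(** The cyclic group generated by x has index less than p, so it contains a Sylow p-subgroup
    P of G. It also normalises P, so there are fewer than p Sylow p-subgroups, and
    their number is 1 modulo p. *)
Lemma normal_cyclic_Sylow p (gT : finGroupType) (G : {group gT}) x :
  prime p -> x \in G -> #|G| < #[x]%g * p ->
  exists P : {group gT}, [/\ p.-Sylow(G) P, P <| G & cyclic P].
Proof.
move=> p_pr Gx lt_Gx; have sXG : <[x]>%g \subset G by rewrite cycle_subG.
have iX : #|G : <[x]>|%g < p.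
  by rewrite -(ltn_pmul2l (cardG_gt0 <[x]>%G)) Lagrange // -orderE.
have [P sylP] := Sylow_exists p <[x]>%G.
have [sPX pP _] := and3P sylP.
have sylPG : p.-Sylow(G) P.
  rewrite pHallE (subset_trans sPX) //= (card_Hall sylP).
  rewrite -(Lagrange sXG) partnM ?cardG_gt0 ?indexg_gt0 //.
  by rewrite [X in _ * X]part_p'nat ?muln1 // p'natE // gtnNdvd ?indexg_gt0.
have cycP := cyclicS sPX (cycle_cyclic x).
exists P; split => //.
have sXN : <[x]>%g \subset 'N_G(P).
  rewrite subsetI sXG cents_norm // centsC (subset_trans sPX) //.
  exact: cycle_abelian.
have n_lt_p : #|'Syl_p(G)| < p.
  rewrite (card_Syl sylPG); apply: leq_ltn_trans iX.
  by rewrite dvdn_leq ?indexg_gt0 // indexgS.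
have := card_Syl_mod G p_pr; rewrite modn_small // => nSyl1.
by rewrite /normal (pHall_sub sylPG) -(subsetIidl G) -indexg_eq1 -(card_Syl sylPG) nSyl1.
Qed.

(** The hypotheses of [ratio_frobenius]: 'C_F(P) is a proper subgroup of the cyclic group F,
    whose index has a prime divisor at least q, so psi drops by a factor q^2 - q + 1; and
    |P| / psi P <= p / (p^2 - p + 1), which decreases in p and p is at least q + 1. *)
Lemma psi_frobenius_lt q p (gT : finGroupType) (P F G : {group gT}) :
  prime q -> prime p -> q < p -> p.-group P -> cyclic P -> P :!=: 1%g ->
  p^'.-group F -> cyclic F -> (forall r, prime r -> r %| #|F| -> q <= r) ->
  P ><| F = G -> ~~ (F \subset 'C(P)) -> psi_ratio_lt q (psi G) (psiC #|G|).
Proof.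
move=> q_pr p_pr lt_qp pP cycP ntP p'F cycF le_qF defG ncPF.
have q_gt1 := prime_gt1 q_pr; have p_gt1 := prime_gt1 p_pr.
have sZF : 'C_F(P) \subset F := subsetIl _ _.
have le_sf : (q.-1 * q + 1) * psi 'C_F(P) <= psi F.
  rewrite (psi_cyclic cycF) (psi_cyclic (cyclicS sZF cycF)).
  apply: psiC_proper_dvd => //; first exact: cardSg.
  apply: contra ncPF => /eqP eq_o; apply/setIidPl/eqP.
  by rewrite eqEcard sZF eq_o leqnn.
have le_ta : #|P| * (q ^ 2 + q + 1) <= q.+1 * psi P.
  have [_ _ [b oP]] := pgroup_pdiv pP ntP.
  have := psiC_mul_prime p_pr (_ : 0 < p ^ b).
  rewrite (psi_cyclic cycP) oP expn_gt0 ltnW //= => /(_ isT); rewrite -expnSr.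
  have := psiC_ge (_ : 0 < p ^ b); rewrite expn_gt0 ltnW //= => /(_ isT).
  move=> le_zc le_C.
  have le_qp : p * (q ^ 2 + q + 1) <= q.+1 * (p.-1 * p + 1).
    by rewrite -(subnKC lt_qp); move: (p - q.+1) => d /=; nia.
  rewrite expnS mulnAC (leq_trans (leq_mul le_qp le_zc)) // -mulnA.
  by rewrite leq_pmul2l // expnS mulnC in le_C *.
have le_s : psi 'C_F(P) <= psi F := psi_sub sZF.
rewrite /psi_ratio_lt (psi_cyclic_sdprod pP cycP p'F defG) natrD !natrM natrB //.
have -> : psiC #|G| = psi P * psi F.
  rewrite -(sdprod_card defG) psiC_mul ?cardG_gt0 ?(pnat_coprime pP) //.
  by rewrite -!psi_cyclic.
rewrite natrM; apply: ratio_frobenius; rewrite ?ler0n ?ltr0n ?ler_nat //.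
- exact: leq_trans (cardG_gt0 P) (card_le_psi P).
- exact: leq_trans (cardG_gt0 F) (card_le_psi F).
- have -> : (q%:R ^+ 2 - q%:R + 1 = (q.-1 * q + 1)%:R :> rat)%R.
    by rewrite natrD natrM -subn1 natrB ?(ltnW q_gt1) //; ring.
  by rewrite -natrM ler_nat mulnC.
have -> : (q%:R ^+ 2 + q%:R + 1 = (q ^ 2 + q + 1)%:R :> rat)%R by rewrite !natrD natrX.
by rewrite natr1 -!natrM ler_nat.
Qed.

(** By [psi_cyclic_sdprod], the two sides differ by
    (psi P - |P|) (psi F - psi 'C_F(P)), whose first factor is positive. *)
Lemma psi_cyclic_sdprod_leif (p : nat) (gT : finGroupType) (P F G : {group gT}) :
  p.-group P -> cyclic P -> P :!=: 1%g -> p^'.-group F -> P ><| F = G ->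
  psi G <= psi P * psi F ?= iff (F \subset 'C(P)).
Proof.
move=> pP cycP ntP p'F defG; rewrite (psi_cyclic_sdprod pP cycP p'F defG).
have sZF : 'C_F(P) \subset F := subsetIl _ _.
have lt_P := card_lt_psi ntP.
have [cPF | ncPF] := boolP (F \subset 'C(P)).
  by rewrite (setIidPl cPF) subnn muln0 addn0; apply/leqif_refl.
have lt_s : psi 'C_F(P) < psi F.
  apply: psi_proper; rewrite properE sZF; apply: contra ncPF.
  by rewrite subsetI => /andP[].
apply/leqifP; rewrite -{2}(subnKC (ltnW lt_s)) mulnDr ltn_add2l ltn_pmul2r //.
by rewrite subn_gt0.
Qed.

(** * The bound and its equality case *)

(** The equality case is stated as an internal direct product inside G, so that the induction
    hypothesis for the complement F can be extended by the central factor P. *)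
Theorem psi_noncyclic_bound q (gT : finGroupType) (G : {group gT}) :
  prime q -> q %| #|G| -> (forall r, prime r -> r %| #|G| -> q <= r) ->
  ~~ cyclic G ->
  psi_ratio_le q (psi G) (psiC #|G|) /\
  (psi_ratio_eq q (psi G) (psiC #|G|) ->
     exists E K : {group gT},
       [/\ E \x K = G, #|E| = q ^ 2, ~~ cyclic E, cyclic K & coprime q #|K|]).
Proof.
move=> q_pr; have [n] := ubnP #|G|; elim: n => // n IHn in G *.
move=> /ltnSE-le_Gn dv_qG le_qG ncG.
have q_gt1 := prime_gt1 q_pr; have G_gt0 := cardG_gt0 G.
have G_gt1 : 1 < #|G| := leq_trans q_gt1 (dvdn_leq G_gt0 dv_qG).
pose p := max_pdiv #|G|; have p_pr : prime p by apply: max_pdiv_prime.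
have dv_pG : p %| #|G| by apply: max_pdiv_dvd.
have le_rp r : prime r -> r %| #|G| -> r <= p.
  by move=> r_pr dv_r; rewrite max_pdiv_max // mem_primes r_pr G_gt0.
have := le_qG p p_pr dv_pG; rewrite leq_eqVlt => /predU1P[eq_qp | lt_qp].
  have qG : q.-group G.
    apply/pgroupP=> r r_pr dv_r; rewrite inE /= eqn_leq le_qG // andbT.
    by rewrite eq_qp le_rp.
  have [le_psi eq_psi] := psi_pgroup_bound q_pr qG ncG.
  split=> // /eq_psi oG; exists G, 1%G.
  by rewrite dprodg1 cyclic1 cards1 coprimen1.
have le_C : q * #|G| ^ 2 <= p.+1 * psiC #|G|.
  apply: psiC_lower_bound => //; first by rewrite leqW // ltnW.
  by move=> r r_pr dv_r; rewrite le_qG ?le_rp.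
have [leG | /forall_inPn[x Gx]] := boolP [forall x in G, #[x]%g * p <= #|G|].
  by apply/psi_ratio_lt_strict/(psi_small_orders q_pr p_pr lt_qp dv_qG le_C)/forall_inP.
rewrite -ltnNge => lt_Gx.
have [P [sylP nsPG cycP]] := normal_cyclic_Sylow p_pr Gx lt_Gx.
have [sPG pP _] := and3P sylP.
have /splitsP[F /complP[tiPF defPF]] := SchurZassenhaus_split (pHall_Hall sylP) nsPG.
have sFG : F \subset G by rewrite -defPF mulG_subr.
have defG : P ><| F = G.
  by rewrite sdprodE // (subset_trans sFG) ?normal_norm.
have oG := sdprod_card defG.
have ntP : P :!=: 1%g.
  rewrite -cardG_gt1 (card_Hall sylP) p_part -(exp1n (logn p #|G|)) ltn_exp2r ?prime_gt1 //.
  by rewrite logn_gt0 mem_primes p_pr G_gt0.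
have p'F : p^'.-group F.
  have := sylP; rewrite /pHall => /and3P[_ _]; rewrite -divgS // -oG mulKn //.
have co_PF : coprime #|P| #|F| := pnat_coprime pP p'F.
have le_qF r : prime r -> r %| #|F| -> q <= r.
  by move=> r_pr dv_r; apply: le_qG (dvdn_trans dv_r (cardSg sFG)).
have [cycF | ncF] := boolP (cyclic F).
  apply: psi_ratio_lt_strict.
  apply: (psi_frobenius_lt q_pr p_pr lt_qp pP cycP ntP p'F cycF le_qF defG).
  apply: contra ncG => cPF; have defGd : P \x F = G by rewrite dprodEsd // centsC.
  by rewrite (cyclic_dprod defGd).
have ndv_qP : ~~ (q %| #|P|).
  by apply/negP=> /(pgroupP pP q q_pr); rewrite inE /= (ltn_eqF lt_qp).
have dv_qF : q %| #|F|.
  by move: dv_qG; rewrite -oG Euclid_dvdM // (negPf ndv_qP).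
have lt_Fn : #|F| < n.
  apply: leq_trans le_Gn; rewrite -oG -{1}(mul1n #|F|) ltn_pmul2r ?cardG_gt0 //.
  by rewrite cardG_gt1.
have [le_F eq_F] := IHn F lt_Fn dv_qF le_qF ncF.
have def_C : psiC #|G| = psi P * psiC #|F|.
  by rewrite -oG psiC_mul ?cardG_gt0 // (psi_cyclic cycP).
have le_PF : psi_ratio_le q (psi P * psi F) (psiC #|G|).
  rewrite /psi_ratio_le def_C !natrM mulrCA [leRHS]mulrCA.
  by rewrite ler_wpM2l ?ler0n.
have [le_psi eq_iff] := psi_cyclic_sdprod_leif pP cycP ntP p'F defG.
have D_gt0 : (0 < ratio_den q%:R :> rat)%R by rewrite ratio_den_gt0 // ler_nat.
split=> [|eq_psi].
  by apply: le_trans le_PF; rewrite ler_pM2l // ler_nat le_psi.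
have eqPF : psi G = psi P * psi F.
  apply/eqP; rewrite eqn_leq le_psi /= -(ler_nat rat) -(ler_pM2l D_gt0).
  by rewrite [leRHS]eq_psi.
have defGd : P \x F = G.
  by rewrite dprodEsd // -eq_iff eqPF.
have eq_psiF : psi_ratio_eq q (psi F) (psiC #|F|).
  apply: (mulfI (_ : (psi P)%:R != 0 :> rat)%R).
    by rewrite pnatr_eq0 -lt0n (leq_trans (cardG_gt0 P) (card_le_psi P)).
  by rewrite mulrCA [RHS]mulrCA -!natrM -eqPF -def_C.
have [E [K [defF oE ncE cycK co_qK]]] := eq_F eq_psiF.
have defEKP : E \x (K \x P) = G by rewrite dprodA defF dprodC.
have [[_ L _ defL] _ _ _] := dprodP defEKP.
have sKF : K \subset F by rewrite -(dprodW defF) mulG_subr.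
exists E, L; split=> //; first by rewrite -defL.
  rewrite (cyclic_dprod defL cycK cycP) coprime_sym.
  exact: coprime_dvdr (cardSg sKF) co_PF.
by rewrite -(dprod_card defL) coprimeMr co_qK prime_coprime.
Qed.

Lemma psi_abelem p (gT : finGroupType) (G : {group gT}) :
  p.-abelem G -> psi G = 1 + (#|G| - 1) * p.
Proof.
move=> abelG; rewrite /psi (bigD1 1%g) //= order1; congr (_ + _).
rewrite -(cards1 (1%g : gT)) -cardsDS ?sub1G // -sum_nat_const.
apply: eq_big => [x|x /andP[Gx ntx]]; first by rewrite !inE andbC.
exact: abelem_order_p abelG Gx ntx.
Qed.

Lemma noncyclic_p2_abelem p (gT : finGroupType) (G : {group gT}) :
  prime p -> #|G| = p ^ 2 -> ~~ cyclic G -> p.-abelem G.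
Proof.
move=> p_pr oG ncG; rewrite abelemE // (card_p2group_abelian p_pr oG).
apply/exponentP=> x Gx; apply/eqP; rewrite -order_dvdn.
have := order_dvdG Gx; rewrite oG => /(dvdn_pfactor _ _ p_pr)[k _ ox].
have := order_lt_card ncG Gx; rewrite oG ox ltn_exp2l ?prime_gt1 // ltnS => le_k1.
by rewrite -[X in _ %| X]expn1 dvdn_exp2l.
Qed.

Lemma Cyc_square_abelem p : prime p -> p.-abelem (setX (Cyc p) (Cyc p)).
Proof.
move=> p_pr; have p_gt0 := prime_gt0 p_pr.
rewrite (dprod_abelem _ (setX_dprod _ _)) -(isog_abelem (setX1_isog _ _)).
by rewrite -(isog_abelem (set1X_isog _ _)) prime_abelem ?card_Cyc.
Qed.

Lemma prime_dvd_fact r m : prime r -> r %| m`! -> r <= m.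
Proof.
move=> r_pr; elim: m => [|m IHm]; first by rewrite fact0 Euclid_dvd1.
by rewrite factS Euclid_dvdM // => /orP[/dvdn_leq->// | /IHm/leqW].
Qed.

(** A common prime divisor of k and of q! is at most q and at least q, hence equal to q. *)
Lemma coprime_fact q k : prime q -> 0 < k -> coprime q k ->
  (forall r, prime r -> r %| k -> q <= r) -> coprime k q`!.
Proof.
move=> q_pr k_gt0 co_qk q_le; apply/negPn/negP=> nco.
have g_gt1 : 1 < gcdn k q`! by rewrite ltn_neqAle eq_sym nco gcdn_gt0 k_gt0.
have := pdiv_dvd (gcdn k q`!); have := pdiv_prime g_gt1; move: (pdiv _) => r r_pr.
rewrite dvdn_gcd => /andP[dv_rk dv_rq].
have le_rq : r <= q by apply: prime_dvd_fact.
have def_r : r = q by apply/eqP; rewrite eqn_leq le_rq q_le.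
by move: co_qk; rewrite prime_coprime // -def_r dv_rk.
Qed.

Lemma isog_square_cyclic q (gT : finGroupType) (G E K : {group gT}) :
  prime q -> E \x K = G -> #|E| = q ^ 2 -> ~~ cyclic E -> cyclic K ->
  G \isog setX (setX (Cyc q) (Cyc q)) (Cyc #|K|).
Proof.
move=> q_pr defG oE ncE cycK; have q_gt0 := prime_gt0 q_pr.
have isoE : E \isog setX (Cyc q) (Cyc q).
  rewrite (isog_abelem_card _ (noncyclic_p2_abelem q_pr oE ncE)) Cyc_square_abelem //.
  by rewrite cardsX !card_Cyc //= oE -mulnn.
apply: isog_dprod defG (setX_dprod _ _) _ _.
  exact: isog_trans isoE (setX1_isog _ _).
exact: isog_trans (isog_Cyc cycK) (set1X_isog _ _).
Qed.

Theorem theorem4 (q n : nat) (gT : finGroupType) (G : {group gT})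
  (q_prime : prime q) (G_qstar : qstar_group q G)
  (G_noncyclic : ~~ cyclic G) (G_order : #|G| = n) :
  let bound : rat :=
    ((((q%:R ^+ 2 - 1) * q%:R + 1) * (q%:R + 1)) / (q%:R ^+ 5 + 1)
       * (psi (Cyc n))%:R)%R in
  ((psi G)%:R <= bound)%R /\
  ((psi G)%:R%R = bound <->
     exists k : nat,
       [/\ 0 < k, n = q ^ 2 * k, coprime k q`! &
           G \isog setX (setX (Cyc q) (Cyc q)) (Cyc k)]).
Proof.
move=> bound; have q_gt1 := prime_gt1 q_prime.
have q_ge2 : (2 <= q%:R :> rat)%R by rewrite ler_nat.
have D_gt0 := ratio_den_gt0 q_ge2.
have dv_qG : q %| #|G| by rewrite -(eqP G_qstar) pdiv_dvd.
have q_le r : prime r -> r %| #|G| -> q <= r.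
  by move=> r_pr dv_r; rewrite -(eqP G_qstar) pdiv_min_dvd ?prime_gt1.
have [le_psi eq_psi] := psi_noncyclic_bound q_prime dv_qG q_le G_noncyclic.
have def_bound : bound = (ratio_num q%:R * (psiC n)%:R / ratio_den q%:R)%R.
  by rewrite /bound ratio_factors // mulrAC.
have bound_eq : (psi G)%:R%R = bound <-> psi_ratio_eq q (psi G) (psiC n).
  rewrite def_bound /psi_ratio_eq; split=> [->|<-].
    by rewrite mulrC divfK // gt_eqF.
  by rewrite mulrAC divff ?mul1r // gt_eqF.
rewrite G_order in le_psi eq_psi q_le.
split; first by rewrite def_bound ler_pdivlMr // mulrC.
rewrite bound_eq; split=> [/eq_psi[E [K [defG oE ncE cycK co_qK]]] | [k [k_gt0 def_n co_kq isoG]]].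
  have oG : n = q ^ 2 * #|K| by rewrite -oE (dprod_card defG).
  exists #|K|; split=> //.
  - apply: coprime_fact => // r r_pr dv_r.
    by apply: q_le => //; rewrite oG dvdn_mull.
  exact: (@isog_square_cyclic q _ G E K).
have q_gt0 := ltnW q_gt1.
have co_qk : coprime (q ^ 2) k.
  rewrite coprimeXl // coprime_sym; apply: coprime_dvdr co_kq.
  by rewrite dvdn_fact // q_gt0 /=.
rewrite /psi_ratio_eq (psi_isog isoG) psi_setX; last by rewrite cardsX !card_Cyc.
rewrite def_n psiC_mul ?expn_gt0 ?q_gt0 //.
rewrite (psi_abelem (Cyc_square_abelem q_prime)) cardsX !card_Cyc //.
rewrite (psiC_primeXS 1) // (psiC_primeXS 0) // expn0 psiC1.
rewrite !muln1 -subn1 !(natrM, natrD, natrB) ?muln_gt0 ?q_gt0 //.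
by rewrite /ratio_num /ratio_den; ring.
Qed.
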